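(* Let $d\in\mathbb{N}$, and let $Y=(Y_t)_{t\in\mathbb{N}_0}$ and $Z=(Z_t)_{t\in\mathbb{N}_0}$ be ergodic ordinal-$d^+$-stationary real-valued stochastic processes on a probability space $(\Omega,\mathcal{A},\mathbb{P})$ with probabilities of pairs of ordinal patterns of order $d$ given by $P=(p_{i,j})_{i,j\in S_d}$ and $Q=(q_{i,j})_{i,j\in S_d}$, respectively. For $L\in\mathbb{N}$ and $\gamma\in(0,1)$, let $\Pi_{L,\gamma}$ be the abstract sequence of ordinal patterns of order $d$ of $$(Y_0,Y_1,\ldots,Y_{\lfloor\gamma L\rfloor},Z_{\lfloor\gamma L\rfloor+1},Z_{\lfloor\gamma L\rfloor+2},\ldots,Z_L).$$ Then for all $\theta\in(0,1)$ it holds $\mathbb{P}$-almost surely that $$\lim_{L\to\infty}\frac1L\,\mathrm{CEofOP}\big(\lfloor\theta L\rfloor;\Pi_{L,\gamma}\big)=\Delta^d_{\gamma,\theta}(P,Q),$$ where $$\Delta^d_{\gamma,\theta}(P,Q)=\begin{cases}H\big(\gamma P+(1-\gamma)Q\big)-\theta H(P)-(1-\theta)H\Big(\frac{\gamma-\theta}{1-\theta}P+\frac{1-\gamma}{1-\theta}Q\Big),&\theta<\gamma,\\[1mm] H\big(\gamma P+(1-\gamma)Q\big)-\theta H\Big(\frac{\gamma}{\theta}P+\frac{\theta-\gamma}{\theta}Q\Big)-(1-\theta)H(Q),&\theta\ge\gamma.\end{cases}$$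
   Context: Conventions: $0\ln 0:=0$ and $0/0:=0$ (so a term $n\ln(n/m)$ with $n=0$ is $0$). Ordinal patterns: for $d\in\mathbb{N}$ let $S_d$ be the set of permutations of $\{0,1,\ldots,d\}$. A vector $(x_0,\ldots,x_d)\in\mathbb{R}^{d+1}$ has ordinal pattern $\mathrm{OP}(x_0,\ldots,x_d)=(r_0,\ldots,r_d)\in S_d$ of order $d$ if $x_{r_0}\ge x_{r_1}\ge\cdots\ge x_{r_d}$ and $r_{l-1}>r_l$ whenever $x_{r_{l-1}}=x_{r_l}$. For a real-valued process $X=(X(t))_{t=0}^{L}$, $L\in\mathbb{N}\cup\{\infty\}$, the abstract sequence of ordinal patterns of order $d$ is $(\Pi(t))_{t=d}^{L}$ with $\Pi(t)=\mathrm{OP}(X(t-d),X(t-d+1),\ldots,X(t))$. Ordinal-$d^+$-stationarity: $X$ is ordinal-$d^+$-stationary if for all $i,j\in S_d$ the probability of pairs of ordinal patterns $p_{i,j}=\mathbb{P}(\Pi(t)=i,\Pi(t+1)=j)$ does not depend on $t$ for $d\le t\le L-1$. Ergodicity: for an ordinal-$d^+$-stationary process with index set $\mathbb{N}_0$, ergodicity is understood here in the sense that for all $i,j\in S_d$, $\mathbb{P}$-almost surely $\frac1n\#\{l\in\{d,\ldots,d+n-1\}\mid \Pi(l)=i,\Pi(l+1)=j\}\to p_{i,j}$ as $n\to\infty$. Entropy function: for a nonnegative array $P=(p_{i,j})_{i,j\in S_d}$, $$H(P)=-\sum_{i\in S_d}\sum_{j\in S_d}p_{i,j}\ln p_{i,j}+\sum_{i\in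 S_d}\Big(\sum_{j\in S_d}p_{i,j}\Big)\ln\sum_{j\in S_d}p_{i,j}.$$ Empirical conditional entropy: for a finite sequence $(\pi(k))_{k=a}^{b}$ of ordinal patterns of order $d$, $a<b$, put $n_{i,j}=\#\{l\in\{a,\ldots,b-1\}\mid\pi(l)=i,\pi(l+1)=j\}$ and $n_i=\#\{l\in\{a,\ldots,b-1\}\mid\pi(l)=i\}$; then $$\mathrm{eCE}\big((\pi(k))_{k=a}^{b}\big)=-\frac1{b-a}\sum_{i\in S_d}\sum_{j\in S_d}n_{i,j}\ln\frac{n_{i,j}}{n_i}.$$ CEofOP statistic: for a sequence $\pi^{d,L}=(\pi(k))_{k=d}^{L}$ of ordinal patterns of order $d$ and $t\in\mathbb{N}$ with $d<t<L-d$, $$\mathrm{CEofOP}(t;\pi^{d,L})=(L-2d)\,\mathrm{eCE}\big((\pi(k))_{k=d}^{L}\big)-(t-d)\,\mathrm{eCE}\big((\pi(k))_{k=d}^{t}\big)-(L-(t+d))\,\mathrm{eCE}\big((\pi(k))_{k=t+d}^{L}\big).$$ For fixed $\theta\in(0,1)$ the value $t=\lfloor\theta L\rfloor$ satisfies $d<t<L-d$ for all sufficiently large $L$. The statistic is evaluated pathwise on abstract sequences of ordinal patterns. *)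

(* Defs.v *)
From HB Require Import structures.
From mathcomp Require Import all_boot all_order all_algebra all_fingroup.
From mathcomp Require Import all_classical all_reals all_analysis.

Set Implicit Arguments.
Unset Strict Implicit.
Unset Printing Implicit Defensive.

Import Order.TTheory GRing.Theory Num.Theory.
Import numFieldNormedType.Exports.

Local Open Scope classical_set_scope.
Local Open Scope ring_scope.

(* [x] has ordinal pattern [r] = (r_0, ..., r_d); for [l : 'I_d], the index
   [widen_ord (leqnSn d) l] has value l and [lift ord0 l] has value l + 1. *)
Definition is_OP (R : realType) (d : nat) (x : 'I_d.+1 -> R) (r : 'S_d.+1) :
    bool :=
  [forall l : 'I_d,
     let a := r (widen_ord (leqnSn d) l) in
     let b := r (lift ord0 l) in
     (x b <= x a) && ((x a == x b) ==> (b < a)%N)].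

(* The default value is never used, see [OP_eq]. *)
Definition OP (R : realType) (d : nat) (x : 'I_d.+1 -> R) : 'S_d.+1 :=
  odflt 1%g [pick r : 'S_d.+1 | is_OP x r].

Section OP_theory.
Variables (R : realType) (d : nat) (x : 'I_d.+1 -> R).

Let op_rel : rel 'I_d.+1 :=
  fun a b => (x b < x a) || ((x a == x b) && (b <= a)%N).

Let op_rel_total : total op_rel.
Proof.
move=> a b; rewrite /op_rel; case: (ltgtP (x a) (x b)) => //= _.
exact: leq_total.
Qed.

Let op_rel_trans : transitive op_rel.
Proof.
move=> b a c; rewrite /op_rel.
case/orP=> [ab|/andP[/eqP ab lab]]; case/orP=> [bc|/andP[/eqP bc lbc]].
- by rewrite (lt_trans bc ab).
- by rewrite -bc ab.
- by rewrite ab bc.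
- by rewrite ab bc eqxx (leq_trans lbc lab) orbT.
Qed.

Let op_rel_anti : antisymmetric op_rel.
Proof.
move=> a b; rewrite /op_rel; case: (ltgtP (x a) (x b)) => //= _ lab.
by apply/val_inj/eqP; rewrite eqn_leq andbC.
Qed.

Let is_OP_sorted (r : 'S_d.+1) :
  is_OP x r = sorted op_rel [seq r i | i <- enum 'I_d.+1].
Proof.
have E (k : nat) (hk : (k < d.+1)%N) :
    nth ord0 [seq r i | i <- enum 'I_d.+1] k = r (Ordinal hk).
  rewrite (nth_map ord0) ?size_enum_ord //; congr (r _).
  by apply/val_inj; rewrite /= nth_enum_ord.
have S (l : 'I_d) : op_rel (r (widen_ord (leqnSn d) l)) (r (lift ord0 l)) =
   (x (r (lift ord0 l)) <= x (r (widen_ord (leqnSn d) l))) &&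
   ((x (r (widen_ord (leqnSn d) l)) == x (r (lift ord0 l))) ==>
    (r (lift ord0 l) < r (widen_ord (leqnSn d) l))%N).
  rewrite /op_rel; set b := r (lift _ _); set a := r (widen_ord _ _).
  have ab : val b != val a.
    apply/negP => /eqP/val_inj/perm_inj/(congr1 val)/= /eqP.
    by rewrite /bump /= add1n => /eqP h; case: (n_Sn _ (esym h)).
  by case: (ltgtP (x a) (x b)) => //= _; rewrite ltn_neqAle ab.
apply/forallP/(sortedP ord0) => [h k|h l].
  rewrite size_map size_enum_ord ltnS => hk.
  rewrite (E k (leqW hk)) (E k.+1 hk).
  have := h (Ordinal hk); rewrite /= -S; congr (op_rel (r _) (r _)).
    exact: val_inj.
  by apply/val_inj; rewrite /= /bump add1n.
have := h l; rewrite size_map size_enum_ord ltnS ltn_ord => /(_ isT).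
have hl : (l < d.+1)%N by apply: leqW.
have hl1 : (l.+1 < d.+1)%N by rewrite ltnS.
rewrite (E l hl) (E l.+1 hl1) /= -S; congr (op_rel (r _) (r _)).
  exact: val_inj.
by apply/val_inj; rewrite /= /bump add1n.
Qed.

Lemma is_OP_inj (r s : 'S_d.+1) : is_OP x r -> is_OP x s -> r = s.
Proof.
rewrite !is_OP_sorted => hr hs; apply/permP => i.
have U (u : 'S_d.+1) : uniq [seq u i | i <- enum 'I_d.+1].
  by rewrite map_inj_uniq ?enum_uniq//; exact: perm_inj.
have M (u : 'S_d.+1) k : k \in [seq u i | i <- enum 'I_d.+1].
  by apply/mapP; exists ((u^-1)%g k); rewrite ?mem_enum// permKV.
have E : [seq r i | i <- enum 'I_d.+1] = [seq s i | i <- enum 'I_d.+1].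
  apply: (sorted_eq op_rel_trans op_rel_anti hr hs).
  by apply: uniq_perm => // k; rewrite !M.
by have /eq_in_map := E; apply; rewrite mem_enum.
Qed.

Lemma is_OP_exists : exists r : 'S_d.+1, is_OP x r.
Proof.
pose s := sort op_rel (enum 'I_d.+1).
have sz : size s = d.+1 by rewrite size_sort size_enum_ord.
have us : uniq s by rewrite sort_uniq enum_uniq.
have inj : injective (fun i : 'I_d.+1 => nth ord0 s i).
  move=> i j /eqP; rewrite nth_uniq ?sz// => /eqP; exact: val_inj.
exists (perm inj); rewrite is_OP_sorted.
suff -> : [seq perm inj i | i <- enum 'I_d.+1] = s.
  by apply: sort_sorted; exact: op_rel_total.
apply: (@eq_from_nth _ ord0); first by rewrite size_map size_enum_ord sz.
move=> k; rewrite size_map size_enum_ord => hk.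
by rewrite (nth_map ord0) ?size_enum_ord// permE nth_enum_ord.
Qed.

Lemma OP_eq (r : 'S_d.+1) : (OP x = r) <-> is_OP x r.
Proof.
have OPx : is_OP x (OP x).
  rewrite /OP; case: pickP => //= h.
  by have [s] := is_OP_exists; rewrite h.
by split=> [<-//|]; exact: is_OP_inj.
Qed.

End OP_theory.

(* A path (x_0, ..., x_L) is encoded by a function on [nat] whose values beyond
   L are irrelevant; [patterns d x t] is meaningful for [d <= t]. *)
Definition patterns (R : realType) (d : nat) (x : nat -> R) (t : nat) :
    'S_d.+1 :=
  OP (fun k : 'I_d.+1 => x (t - d + k)%N).

Definition pair_count (d : nat) (p : nat -> 'S_d.+1) (a b : nat)
    (i j : 'S_d.+1) : nat :=
  count (fun l => (p l == i) && (p l.+1 == j)) (index_iota a b).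

Definition pattern_count (d : nat) (p : nat -> 'S_d.+1) (a b : nat)
    (i : 'S_d.+1) : nat :=
  count (fun l => p l == i) (index_iota a b).

(* [ln] and division are total and a zero factor makes the term vanish, so the
   conventions 0 ln 0 = 0 and 0/0 = 0 need no case distinction, here and in
   [entropy]. *)
Definition eCE (R : realType) (d : nat) (p : nat -> 'S_d.+1) (a b : nat) : R :=
  - (b - a)%:R^-1 *
  \sum_(i : 'S_d.+1) \sum_(j : 'S_d.+1)
     (pair_count p a b i j)%:R *
     ln ((pair_count p a b i j)%:R / (pattern_count p a b i)%:R).

(* Meaningful for d < t < L - d, so that no natural subtraction truncates. *)
Definition CEofOP (R : realType) (d L t : nat) (p : nat -> 'S_d.+1) : R :=
  (L - 2 * d)%:R * eCE R p d L
  - (t - d)%:R * eCE R p d t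
  - (L - (t + d))%:R * eCE R p (t + d)%N L.

Definition entropy (R : realType) (d : nat) (P : 'S_d.+1 -> 'S_d.+1 -> R) : R :=
  - (\sum_(i : 'S_d.+1) \sum_(j : 'S_d.+1) P i j * ln (P i j))
  + \sum_(i : 'S_d.+1) (\sum_(j : 'S_d.+1) P i j) * ln (\sum_(j : 'S_d.+1) P i j).

Definition lincomb (R : realType) (d : nat)
    (a : R) (P : 'S_d.+1 -> 'S_d.+1 -> R)
    (b : R) (Q : 'S_d.+1 -> 'S_d.+1 -> R) : 'S_d.+1 -> 'S_d.+1 -> R :=
  fun i j => a * P i j + b * Q i j.

Definition Delta (R : realType) (d : nat) (gamma theta : R)
    (P Q : 'S_d.+1 -> 'S_d.+1 -> R) : R :=
  if theta < gamma then
    entropy (lincomb gamma P (1 - gamma) Q)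
    - theta * entropy P
    - (1 - theta) * entropy (lincomb ((gamma - theta) / (1 - theta)) P
                                     ((1 - gamma) / (1 - theta)) Q)
  else
    entropy (lincomb gamma P (1 - gamma) Q)
    - theta * entropy (lincomb (gamma / theta) P ((theta - gamma) / theta) Q)
    - (1 - theta) * entropy Q.

Definition splice (R : realType) (m : nat) (y z : nat -> R) : nat -> R :=
  fun t => if (t <= m)%N then y t else z t.

Section processes.
Context (disp : measure_display) (Omega : measurableType disp) (R : realType).
Variables (Pr : probability Omega R) (d : nat) (X : nat -> {RV Pr >-> R}).

Definition pair_prob (t : nat) (i j : 'S_d.+1) : \bar R :=
  Pr [set w | patterns d (fun s => X s w) t = i /\
              patterns d (fun s => X s w) t.+1 = j].

Definition ordinal_stationary : Prop :=
  forall (i j : 'S_d.+1) (s t : nat), (d <= s)%N -> (d <= t)%N ->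
    pair_prob s i j = pair_prob t i j.

Definition has_pair_probs (P : 'S_d.+1 -> 'S_d.+1 -> R) : Prop :=
  forall (i j : 'S_d.+1) (t : nat), (d <= t)%N -> pair_prob t i j = (P i j)%:E.

Definition ordinal_ergodic (P : 'S_d.+1 -> 'S_d.+1 -> R) : Prop :=
  forall i j : 'S_d.+1,
    {ae Pr, forall w,
      (fun n : nat =>
         n%:R^-1 *
         (pair_count (patterns d (fun s => X s w)) d (d + n)%N i j)%:R : R)
        @ \oo --> P i j}.

End processes.

(* Main.v *)
Require Import Defs.
From HB Require Import structures.
From mathcomp Require Import all_boot all_order all_algebra all_fingroup.
From mathcomp Require Import all_classical all_reals all_analysis.
From mathcomp Require Import ring lra zify.

Import Order.TTheory GRing.Theory Num.Theory.
Import numFieldNormedType.Exports.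

Local Open Scope classical_set_scope.
Local Open Scope ring_scope.

(** The theorem is pathwise and deterministic: for almost every [w], all the
    finitely many pair frequencies of the two paths converge, and
    this alone forces the limit of the statistic ([cvg_CEofOP_splice]).

    Since the row sums of the pair counts are the pattern counts, [b - a] times
    the empirical conditional entropy over [[a, b)] is exactly the entropy
    function [H] of the array of pair counts ([mul_eCE_entropy]).  As [H] is
    homogeneous of degree one ([entropyZ]), dividing the statistic by [L] turns
    its three terms into [H] of the pair counts divided by [L], up to the factor
    [(L - 2 d) / (L - d)], which tends to 1, in the first one.  [H] is
    continuous ([entropy_cvg]), because [x ln x] is, including at 0.  So only
    the limits of the rescaled counts matter.

    Up to the change point [m = floor (gamma L)] the spliced path has the
    patterns of [Y], after [m + d] those of [Z]; the windows in between
    contribute at most [d + 1] pairs, which is negligible.  If [k] grows like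
    [kappa L], the count up to time [k] is therefore asymptotically
    [L (min kappa gamma * P + (kappa - min kappa gamma) * Q)]
    ([cvg_pair_count_splice]).  Taking [kappa = 1] and [kappa = theta], and the
    difference of both for the last window, gives three limit arrays.  The
    two cases of [Delta] are the two values of [min theta gamma], with the
    factors [theta] and [1 - theta] pulled out of [H] by homogeneity
    ([DeltaE]). *)

(** * Continuity and homogeneity of the entropy function *)

(** With [s = sqrt x] one has [x ln x = - 2 s (s ln (1 / s))], and
    [ln (1 / s) < 1 / s].  This is the modulus of continuity at 0 needed
    below. *)
Lemma norm_xlnx_le (R : realType) (x : R) :
  x <= 1 -> `|x * ln x| <= 2 * Num.sqrt x.
Proof.
move=> x1; have [x0|x0] := leP x 0.
  by rewrite ln0// mulr0 normr0 mulr_ge0// sqrtr_ge0.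
have s0 : 0 < Num.sqrt x by rewrite sqrtr_gt0.
have xE : x = Num.sqrt x ^+ 2 by rewrite sqr_sqrtr// ltW.
have lnE : ln x = ln (Num.sqrt x) *+ 2 by rewrite {1}xE lnXn.
have V : - ln (Num.sqrt x) < (Num.sqrt x)^-1.
  by rewrite -lnV ?posrE// ln_sublinear// invr_gt0.
have lnx0 : ln x <= 0 by exact: ln_le0.
rewrite normrM (gtr0_norm x0) (ler0_norm lnx0) lnE mulr2n {1}xE expr2.
have : Num.sqrt x * - ln (Num.sqrt x) <= 1.
  by rewrite -(mulfV (lt0r_neq0 s0)) ler_pM2l// ltW.
nra.
Qed.

(** Continuity holds on the whole line, because [ln] vanishes on nonpositive
    arguments; the only delicate point is 0. *)
Lemma continuous_xlnx (R : realType) : continuous (fun x : R => x * ln x).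
Proof.
move=> x; have [x0|x0|<-] := ltgtP 0 x;
  rewrite /continuous_at; cbv beta.
- by apply: cvgM; [exact: cvg_id | exact: continuous_ln].
- rewrite (ln0 (ltW x0)) mulr0.
  apply: cvg_near_cst; near=> y.
  rewrite ln0 ?mulr0//; apply: ltW; near: y; exact: lt_nbhsl.
- rewrite mul0r; apply/norm_cvg0P.
  apply: (@squeeze_cvgr _ _ _ _ (cst 0) (fun x => 2 * Num.sqrt x)).
  + near=> y; rewrite /= normr_ge0/=; apply: norm_xlnx_le.
    apply: ltW; near: y; apply: lt_nbhsl; exact: ltr01.
  + exact: cvg_cst.
  + rewrite -[X in _ --> X](mulr0 2) -[X in _ * X](sqrtr0 R).
    apply: cvgM; [exact: cvg_cst | exact: sqrt_continuous].
Unshelve. all: by end_near. Qed.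

Lemma cvg_sumr (R : realType) (I : finType) (F : set_system nat)
    {FF : Filter F} (f : I -> nat -> R) (l : I -> R) :
  (forall i, f i n @[n --> F] --> l i) ->
  \sum_i f i n @[n --> F] --> \sum_i l i.
Proof. by move=> h; apply: cvg_big => [|i _]; [exact: add_continuous|]. Qed.

Lemma entropy_cvg (R : realType) (d : nat)
    (A : nat -> 'S_d.+1 -> 'S_d.+1 -> R) (B : 'S_d.+1 -> 'S_d.+1 -> R) :
  (forall i j, A n i j @[n --> \oo] --> B i j) ->
  entropy (A n) @[n --> \oo] --> entropy B.
Proof.
move=> AB.
have xlnx (f : nat -> R) (l : R) : f n @[n --> \oo] --> l ->
    f n * ln (f n) @[n --> \oo] --> l * ln l.
  move=> fl.
  exact: (cvg_comp f (fun x : R => x * ln x) fl (@continuous_xlnx R l)).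
apply: cvgD.
  by apply: cvgN; do 2![apply: cvg_sumr => ?]; exact: xlnx.
by apply: cvg_sumr => i; apply: xlnx; apply: cvg_sumr.
Qed.

(** Scaling adds [c ln c] times the total mass to each of the two sums of the
    entropy, and these contributions cancel.  Nonnegativity is what makes
    [ln (c * x) = ln c + ln x] usable, the case [x = 0] being trivial. *)
Lemma entropyZ (R : realType) (d : nat) (c : R)
    (B : 'S_d.+1 -> 'S_d.+1 -> R) : 0 < c -> (forall i j, 0 <= B i j) ->
  entropy (fun i j => c * B i j) = c * entropy B.
Proof.
move=> c0 B0.
have xlnx x : 0 <= x -> c * x * ln (c * x) = c * (x * ln x) + c * ln c * x.
  rewrite le_eqVlt => /predU1P[<-|x0]; first by rewrite !(mulr0, mul0r, addr0).
  by rewrite lnM ?posrE//; ring.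
rewrite /entropy.
under eq_bigr do
  [under eq_bigr do rewrite xlnx//; rewrite big_split/= -!mulr_sumr].
under [X in _ + X]eq_bigr do rewrite -mulr_sumr xlnx ?sumr_ge0//.
rewrite !big_split/= -!mulr_sumr; ring.
Qed.

(** * Empirical conditional entropy as the entropy of the pair counts *)

Lemma sum_pair_count (d : nat) (p : nat -> 'S_d.+1) (a b : nat) (i : 'S_d.+1) :
  (\sum_j pair_count p a b i j)%N = pattern_count p a b i.
Proof.
rewrite /pair_count /pattern_count; elim: (index_iota a b) => [|l s IH] /=.
  by rewrite big1.
rewrite big_split/= IH; congr addn.
rewrite (bigD1 (p l.+1))//= eqxx andbT big1 ?addn0// => j.
by rewrite eq_sym => /negbTE->; rewrite andbF.
Qed.

Lemma eCE_entropy (R : realType) (d : nat) (p : nat -> 'S_d.+1) (a b : nat) :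
  eCE R p a b =
  (b - a)%:R^-1 * entropy (fun i j => (pair_count p a b i j)%:R : R).
Proof.
rewrite /eCE /entropy mulNr -mulrN; congr (_ * _).
rewrite -[RHS]opprK opprD opprK; congr (- _).
rewrite -sumrB; apply: eq_bigr => i _.
rewrite -natr_sum sum_pair_count.
transitivity (\sum_j ((pair_count p a b i j)%:R * ln (pair_count p a b i j)%:R
   - (pair_count p a b i j)%:R * ln (pattern_count p a b i)%:R : R)).
  apply: eq_bigr => j _.
  have [->|n0] := posnP (pair_count p a b i j); first by rewrite !mul0r subr0.
  have ni0 : (0 < pattern_count p a b i)%N.
    by rewrite -sum_pair_count (bigD1 j)//= ltn_addr.
  by rewrite ln_div ?posrE ?ltr0n// mulrBr.
by rewrite sumrB -mulr_suml -natr_sum sum_pair_count.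
Qed.

(** On an empty window, where the inverse in [eCE] is that of 0, all counts
    vanish and both sides are 0. *)
Lemma mul_eCE_entropy (R : realType) (d : nat) (p : nat -> 'S_d.+1)
    (a b : nat) :
  (b - a)%:R * eCE R p a b =
  entropy (fun i j => (pair_count p a b i j)%:R : R).
Proof.
rewrite eCE_entropy; have [ba|ba] := posnP (b - a)%N; last first.
  by rewrite mulVKf// pnatr_eq0 -lt0n.
rewrite ba mul0r; apply/esym.
have E i j : pair_count p a b i j = 0%N by rewrite /pair_count /index_iota ba.
rewrite /entropy big1 => [|i _]; last first.
  by rewrite big1// => j _; rewrite E mul0r.
by rewrite big1 ?oppr0 ?addr0// => i _; rewrite big1 ?mul0r// => j _; rewrite E.
Qed.

(** * Counting along a spliced sequence *)

Lemma count_index_iotaS (a : pred nat) (s n : nat) :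
  count a (index_iota s n.+1) =
  (count a (index_iota s n) + ((s <= n) && a n))%N.
Proof.
rewrite /index_iota; have [sn|ns] := leqP s n.
  by rewrite subSn// -addn1 iotaD count_cat/= subnKC// addn0.
have -> : (n.+1 - s = 0)%N by lia.
by have -> : (n - s = 0)%N by lia.
Qed.

(** The bound is uniform in [n]: [c] counts like [a] before [m] and like [b]
    from [m + k] on, and only the [k] indices in between can be miscounted. *)
Lemma count_splice (R : realType) (a b c : pred nat) (s m k n : nat) :
  (forall l, (s <= l < m)%N -> c l = a l) ->
  (forall l, (m + k <= l)%N -> c l = b l) ->
  let N := fun (x : pred nat) i => (count x (index_iota s i))%:R : R in
  `|N c n - (N a (minn n m) + (N b n - N b (minn n m)))| <= k%:R.
Proof.
move=> ca cb; pose N (x : pred nat) i : R := (count x (index_iota s i))%:R.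
rewrite /= -!/(N _ _).
(* The error so far is at most the number of indices of [[m, m + k)] already
   passed, which is the form that goes through by induction. *)
suff : `|N c n - (N a (minn n m) + (N b n - N b (minn n m)))|
         <= (minn (n - m) k)%:R.
  by move=> /le_trans; apply; rewrite ler_nat geq_minr.
have NS x i : N x i.+1 = N x i + ((s <= i)%N && x i)%:R.
  by rewrite /N count_index_iotaS natrD.
elim: n => [|n IH].
  have N0 x : N x 0%N = 0 by rewrite /N /index_iota sub0n.
  by rewrite min0n !N0 !subrr addr0 subrr normr0.
have [nm|mn] := ltnP n m.
  move: IH; rewrite (minn_idPl nm) (minn_idPl (ltnW nm)).
  have -> : (n - m = 0)%N by lia.
  have -> : (n.+1 - m = 0)%N by lia.
  rewrite !NS; have [sn|//] := leqP s n; last by rewrite !addr0.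
  rewrite ca ?sn//= => IH; apply: le_trans IH.
  by rewrite le_eqVlt; apply/orP; left; apply/eqP; congr `|_|; ring.
move: IH; rewrite (minn_idPr mn) (minn_idPr (leqW mn)) !NS => IH.
set e := _ - (_ + (_ - _)).
have -> : e = N c n - (N a m + (N b n - N b m))
              + (((s <= n)%N && c n)%:R - ((s <= n)%N && b n)%:R).
  by rewrite /e; ring.
apply: le_trans (ler_normD _ _) _.
have [kn|kn] := leqP (m + k) n.
  rewrite cb// subrr normr0 addr0; apply: le_trans IH _.
  by rewrite ler_nat; lia.
have -> : minn (n.+1 - m) k = (minn (n - m) k).+1 by lia.
rewrite -natr1; apply: lerD => //.
by case: (_ && c n); case: (_ && b n);
  rewrite ?subrr ?subr0 ?sub0r ?normrN ?normr1 ?normr0.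
Qed.

(** The lower bound on [l] keeps the truncated subtraction [l - d] honest: the
    window ends at [l], so at most at the change point. *)
Lemma patterns_splice_left (R : realType) (d m l : nat) (y z : nat -> R) :
  (d <= l <= m)%N -> patterns d (splice m y z) l = patterns d y l.
Proof.
move=> /andP[dl lm]; rewrite /patterns; congr OP; apply/funext => k.
by rewrite /splice ifT//; have := ltn_ord k; lia.
Qed.

Lemma patterns_splice_right (R : realType) (d m l : nat) (y z : nat -> R) :
  (m + d < l)%N -> patterns d (splice m y z) l = patterns d z l.
Proof.
move=> ml; rewrite /patterns; congr OP; apply/funext => k.
by rewrite /splice ifF//; lia.
Qed.

(** * Linear growth of integer sequences *)

Section growth.
Variable R : realType.
Implicit Types (k m : nat -> nat) (u : nat -> R).

Lemma cvg_divn (c : R) : (c / n%:R) @[n --> \oo] --> 0.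
Proof.
rewrite -[X in _ --> X](mulr0 c); apply: cvgM; first exact: cvg_cst.
by apply/gtr0_cvgV0; [near=> n; rewrite ltr0n; near: n; exact: nbhs_infty_gt
  | exact: cvgr_idn].
Unshelve. all: by end_near. Qed.

Lemma cvg_divn_bounded u (c : R) :
  (forall n, `|u n| <= c) -> (u n / n%:R) @[n --> \oo] --> 0.
Proof.
move=> uc; apply/norm_cvg0P.
apply: (@squeeze_cvgr _ _ _ _ (cst 0) (fun n => c / n%:R)).
- near=> n; rewrite /= normr_ge0/= normrM normfV normr_nat.
  by rewrite ler_wpM2r// invr_ge0.
- exact: cvg_cst.
- exact: cvg_divn.
Unshelve. all: by end_near. Qed.

Lemma cvg_divn_self : (n%:R / n%:R : R) @[n --> \oo] --> (1 : R).
Proof.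
apply: cvg_near_cst; near=> n; rewrite divff// pnatr_eq0 -lt0n.
by near: n; exact: nbhs_infty_gt.
Unshelve. all: by end_near. Qed.

Lemma cvg_divn_subn k (s : nat) (c : R) :
  ((k n)%:R / n%:R) @[n --> \oo] --> c ->
  ((k n - s)%:R / n%:R) @[n --> \oo] --> c.
Proof.
move=> kc; rewrite -[c]addr0.
have -> : (fun n => (k n - s)%:R / n%:R : R) =
    (fun n => (k n)%:R / n%:R + ((k n - s)%:R - (k n)%:R) / n%:R).
  by apply/funext => n; rewrite -mulrDl addrC subrK.
apply: cvgD => //; apply: (cvg_divn_bounded _ s%:R) => n.
rewrite distrC; have [sk|ks] := leqP s (k n).
  by rewrite natrB// opprB addrC subrK normr_nat.
have -> : (k n - s = 0)%N by lia.
by rewrite subr0 normr_nat ler_nat ltnW.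
Qed.

Lemma cvg_divn_addn k (s : nat) (c : R) :
  ((k n)%:R / n%:R) @[n --> \oo] --> c ->
  ((k n + s)%:R / n%:R) @[n --> \oo] --> c.
Proof.
move=> kc; rewrite -[c]addr0.
under eq_fun do rewrite natrD mulrDl.
by apply: cvgD => //; exact: cvg_divn.
Qed.

Lemma cvg_divn_truncn (c : R) : 0 <= c ->
  ((Num.truncn (c * n%:R))%:R / n%:R) @[n --> \oo] --> c.
Proof.
move=> c0; rewrite -[X in _ --> X]addr0.
apply: (@cvg_trans _ ((c * (n%:R / n%:R) +
   ((Num.truncn (c * n%:R))%:R - c * n%:R) / n%:R) @[n --> \oo])).
  apply: near_eq_cvg; near=> n; rewrite mulrA -mulrDl; congr (_ / _); ring.
apply: cvgD.
  rewrite -[X in _ --> X]mulr1; apply: cvgM; first exact: cvg_cst.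
  exact: cvg_divn_self.
apply: (cvg_divn_bounded _ 1) => n.
have /truncn_itv/andP[] : 0 <= c * n%:R by rewrite mulr_ge0.
rewrite -natr1 => h1 h2; rewrite ler_norml; apply/andP; split; lra.
Unshelve. all: by end_near. Qed.

Lemma cvg_divn_minn k m (c e : R) :
  ((k n)%:R / n%:R) @[n --> \oo] --> c ->
  ((m n)%:R / n%:R) @[n --> \oo] --> e ->
  ((minn (k n) (m n))%:R / n%:R) @[n --> \oo] --> Num.min c e.
Proof.
move=> kc me; rewrite minr_absE.
have -> : (fun n => (minn (k n) (m n))%:R / n%:R : R) =
    (fun n => ((k n)%:R / n%:R + (m n)%:R / n%:R
               - `|(k n)%:R / n%:R - (m n)%:R / n%:R|) / 2).
  apply/funext => n; rewrite -minr_absE -minr_pMl ?invr_ge0//.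
  by rewrite -natr_min.
apply: cvgM; last exact: cvg_cst.
apply: cvgB; first exact: cvgD.
by apply: cvg_norm; exact: cvgB.
Qed.

Lemma cvg_divn_infty k (c : R) : 0 < c ->
  ((k n)%:R / n%:R) @[n --> \oo] --> c -> k n @[n --> \oo] --> \oo.
Proof.
move=> c0 kc; apply/(@cvgrnyP R)/cvgryPge => A.
have c2 : c / 2 < c by lra.
near=> n.
have n0 : (0 : R) < n%:R by rewrite ltr0n; near: n; exact: nbhs_infty_gt.
have h : c / 2 < (k n)%:R / n%:R by near: n; exact: (cvgr_gt _ kc).
have hA : A / (c / 2) <= n%:R by near: n; exact: nbhs_infty_ger.
move: h hA; rewrite ltr_pdivlMr// ler_pdivrMr; last lra.
by rewrite mulrC => h /le_trans; apply; rewrite ltW// mulrC.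
Unshelve. all: by end_near. Qed.

(** A positive rate [c] forces [k n] to infinity, so that the convergence of
    [N n / n] can be sampled along [k]; [N 0 = 0] covers the finitely many [n]
    with [k n = 0]. *)
Lemma cvg_divn_comp (N k : nat -> nat) (p c : R) : N 0%N = 0%N -> 0 < c ->
  ((N n)%:R / n%:R) @[n --> \oo] --> p ->
  ((k n)%:R / n%:R) @[n --> \oo] --> c ->
  ((N (k n))%:R / n%:R) @[n --> \oo] --> c * p.
Proof.
move=> N0 c0 Np kc.
have -> : (fun n => (N (k n))%:R / n%:R : R) =
    (fun n => (k n)%:R / n%:R * ((N (k n))%:R / (k n)%:R)).
  apply/funext => n; have [->|kn] := posnP (k n); first by rewrite N0 !mul0r.
  by rewrite [RHS]mulrC mulrA divfK// pnatr_eq0 -lt0n.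
apply: cvgM => //.
have kinfty := cvg_divn_infty _ _ c0 kc.
exact: (cvg_comp k (fun n => (N n)%:R / n%:R : R) kinfty Np).
Qed.

(** Passes from counts over a window of length [n] to counts up to time [n]:
    the two normalisations differ by the factor [(n - s) / n], which tends
    to 1. *)
Lemma cvg_divn_shift (N : nat -> nat) (s : nat) (p : R) :
  (n%:R^-1 * (N (s + n)%N)%:R) @[n --> \oo] --> p ->
  ((N n)%:R / n%:R) @[n --> \oo] --> p.
Proof.
move=> Np; rewrite -[p]mulr1.
apply: (@cvg_trans _ (((n - s)%:R^-1 * (N (s + (n - s))%N)%:R
    * ((n - s)%:R / n%:R)) @[n --> \oo])).
  apply: near_eq_cvg; near=> n.
  have sn : (s < n)%N by near: n; exact: nbhs_infty_gt.
  have n0 : (n - s)%:R != 0 :> R by rewrite pnatr_eq0 -lt0n subn_gt0.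
  by rewrite subnKC ?(ltnW sn)// mulrAC mulrA mulVf// mul1r mulrC.
apply: cvgM; last by apply: cvg_divn_subn; exact: cvg_divn_self.
have h : (n - s)%N @[n --> \oo] --> \oo.
  apply: (cvg_divn_infty _ 1) => //.
  by apply: cvg_divn_subn; exact: cvg_divn_self.
exact: (cvg_comp (subn^~ s) (fun n => n%:R^-1 * (N (s + n)%N)%:R : R) h Np).
Unshelve. all: by end_near. Qed.

(** The spliced count is the [a]-count up to [min (k n) (m n)] plus the
    [b]-count from there to [k n], with an error of at most [h]; each of these
    counts follows its own frequency. *)
Lemma cvg_count_splice (a b : pred nat) (c : nat -> pred nat)
    (s h : nat) k m (p q kappa gamma : R) :
  0 < kappa -> 0 < gamma ->
  (forall n l, (s <= l < m n)%N -> c n l = a l) ->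
  (forall n l, (m n + h <= l)%N -> c n l = b l) ->
  ((count a (index_iota s n))%:R / n%:R) @[n --> \oo] --> p ->
  ((count b (index_iota s n))%:R / n%:R) @[n --> \oo] --> q ->
  ((k n)%:R / n%:R) @[n --> \oo] --> kappa ->
  ((m n)%:R / n%:R) @[n --> \oo] --> gamma ->
  ((count (c n) (index_iota s (k n)))%:R / n%:R) @[n --> \oo] -->
    Num.min kappa gamma * p + (kappa - Num.min kappa gamma) * q.
Proof.
move=> kappa0 gamma0 ca cb ap bq kc mc.
pose N (x : pred nat) i := count x (index_iota s i).
have N0 x : N x 0%N = 0%N by rewrite /N /index_iota sub0n.
have min0 : 0 < Num.min kappa gamma by rewrite lt_min kappa0.
have minc := cvg_divn_minn _ _ _ _ kc mc.
pose M n := minn (k n) (m n).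
have -> : (fun n => (count (c n) (index_iota s (k n)))%:R / n%:R : R) =
    (fun n => (N a (M n))%:R / n%:R + ((N b (k n))%:R / n%:R
       - (N b (M n))%:R / n%:R)
     + ((N (c n) (k n))%:R
          - ((N a (M n))%:R + ((N b (k n))%:R - (N b (M n))%:R))) / n%:R).
  by apply/funext => n; rewrite -!mulrBl -!mulrDl; congr (_ / _);
    rewrite addrC subrK.
rewrite -[X in _ --> X]addr0; apply: cvgD; last first.
  by apply: (cvg_divn_bounded _ h%:R) => n; apply: count_splice => l;
    [exact: ca | exact: cb].
rewrite mulrBl; apply: cvgD.
  exact: (cvg_divn_comp _ _ _ _ (N0 a) min0 ap minc).
by apply: cvgB; [exact: (cvg_divn_comp _ _ _ _ (N0 b) kappa0 bq kc)
  | exact: (cvg_divn_comp _ _ _ _ (N0 b) min0 bq minc)].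
Qed.

End growth.

Lemma cvg_subn_ratio (R : realType) (s r : nat) :
  ((n - s)%:R / (n - r)%:R : R) @[n --> \oo] --> (1 : R).
Proof.
have h k := cvg_divn_subn R id k 1 (cvg_divn_self R).
rewrite -[X in _ --> X]divr1.
apply: (@cvg_trans _ (((n - s)%:R / n%:R / ((n - r)%:R / n%:R) : R)
    @[n --> \oo])).
  apply: near_eq_cvg; near=> n.
  have n0 : (0 : R) != n%:R.
    by rewrite eq_sym pnatr_eq0 -lt0n; near: n; exact: nbhs_infty_gt.
  by rewrite invf_div mulrA divfK// eq_sym.
by apply: cvgM; [exact: h | apply: cvgV; [exact: oner_neq0 | exact: h]].
Unshelve. all: by end_near. Qed.

Lemma pair_count_catB (R : realType) (d : nat) (q : nat -> 'S_d.+1)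
    (a b c : nat) (i j : 'S_d.+1) :
  (a <= b <= c)%N ->
  (pair_count q b c i j)%:R =
  (pair_count q a c i j)%:R - (pair_count q a b i j)%:R :> R.
Proof.
move=> /andP[ab bc]; rewrite /pair_count /index_iota.
have -> : (c - a = (b - a) + (c - b))%N by lia.
by rewrite iotaD count_cat subnKC// natrD addrC addKr.
Qed.

(** * The change-point statistic along a pair of paths *)

Section paths.
Variables (R : realType) (d : nat) (y z : nat -> R).
Variables (P Q : 'S_d.+1 -> 'S_d.+1 -> R) (gamma : R).
Hypothesis yP : forall i j : 'S_d.+1,
  (n%:R^-1 * (pair_count (patterns d y) d (d + n)%N i j)%:R)
    @[n --> \oo] --> P i j.
Hypothesis zQ : forall i j : 'S_d.+1,
  (n%:R^-1 * (pair_count (patterns d z) d (d + n)%N i j)%:R)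
    @[n --> \oo] --> Q i j.
Hypotheses (P0 : forall i j, 0 <= P i j) (Q0 : forall i j, 0 <= Q i j).
Hypotheses (gamma0 : 0 < gamma) (gamma1 : gamma < 1).

Let p (L : nat) : nat -> 'S_d.+1 :=
  patterns d (splice (Num.truncn (gamma * L%:R)) y z).

Lemma cvg_pair_count_splice (k : nat -> nat) (kappa : R) (i j : 'S_d.+1) :
  0 < kappa -> ((k L)%:R / L%:R) @[L --> \oo] --> kappa ->
  (L%:R^-1 * (pair_count (p L) d (k L) i j)%:R) @[L --> \oo] -->
    lincomb (Num.min kappa gamma) P (kappa - Num.min kappa gamma) Q i j.
Proof.
move=> kappa0 kc.
under eq_fun do rewrite mulrC.
pose ind (x : nat -> R) := fun l =>
  (patterns d x l == i) && (patterns d x l.+1 == j).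
(* A pair of patterns at [l] sees times [l - d] to [l + 1], hence the width
   [d + 1] of the transition zone. *)
apply: (cvg_count_splice R (ind y) (ind z)
  (fun L => ind (splice (Num.truncn (gamma * L%:R)) y z)) d d.+1 k
  (fun L => Num.truncn (gamma * L%:R))) => //.
- move=> L l /andP[dl lm]; rewrite /ind !patterns_splice_left//; lia.
- move=> L l ml; rewrite /ind !patterns_splice_right//; lia.
- exact: (cvg_divn_shift R (fun n => pair_count (patterns d y) d n i j) d).
- exact: (cvg_divn_shift R (fun n => pair_count (patterns d z) d n i j) d).
- by apply: cvg_divn_truncn; exact: ltW.
Qed.

Lemma lincomb_ge0 (a b : R) : 0 <= a -> 0 <= b ->
  forall i j, 0 <= lincomb a P b Q i j.
Proof. by move=> a0 b0 i j; rewrite addr_ge0// mulr_ge0. Qed.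

Variable theta : R.
Hypotheses (theta0 : 0 < theta) (theta1 : theta < 1).

Let mu := Num.min theta gamma.

(** Absorbing the weights [theta] and [1 - theta] into the arrays merges the two
    cases of [Delta]: of the total weight [gamma] of [P], the part [mu] falls
    before time [theta] and the part [gamma - mu] after it. *)
Lemma DeltaE :
  Delta gamma theta P Q =
  entropy (lincomb gamma P (1 - gamma) Q)
  - entropy (lincomb mu P (theta - mu) Q)
  - entropy (lincomb (gamma - mu) P (1 - theta - (gamma - mu)) Q).
Proof.
rewrite /Delta /mu; case: ltP => h.
  rewrite -!entropyZ ?subr_gt0//; last first.
    by apply: lincomb_ge0; rewrite divr_ge0// ?subr_ge0 ltW.
  congr (_ - _ - _); congr entropy; apply/funext => i; apply/funext => j.
    by rewrite /lincomb subrr mul0r addr0.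
  rewrite /lincomb mulrDr !mulrA; congr (_ * _ + _ * _).
    by rewrite mulrC mulKf// gt_eqF// subr_gt0.
  by rewrite mulrC mulKf ?gt_eqF ?subr_gt0//; ring.
rewrite -!entropyZ ?subr_gt0//; last first.
  by apply: lincomb_ge0; rewrite divr_ge0// ?subr_ge0// ltW.
congr (_ - _ - _); congr entropy; apply/funext => i; apply/funext => j.
  by rewrite /lincomb mulrDr !mulrA; congr (_ * _ + _ * _);
    rewrite mulrC mulKf// gt_eqF.
by rewrite /lincomb subrr mul0r add0r subr0.
Qed.

Lemma cvg_CEofOP_splice :
  (L%:R^-1 * CEofOP R L (Num.truncn (theta * L%:R)) (p L))
    @[L --> \oo] --> Delta gamma theta P Q.
Proof.
pose t L := Num.truncn (theta * L%:R).
pose E a b L : R :=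
  entropy (fun i j => L%:R^-1 * (pair_count (p L) a b i j)%:R : R).
have tc : ((t L)%:R / L%:R : R) @[L --> \oo] --> theta.
  by apply: cvg_divn_truncn; exact: ltW.
have tdc := cvg_divn_addn R t d theta tc.
apply: (@cvg_trans _ (((L - 2 * d)%:R / (L - d)%:R * E d L L
    - E d (t L) L - E (t L + d)%N L L : R) @[L --> \oo])).
  apply: near_eq_cvg; near=> L.
  have L0 : (0 : R) < L%:R^-1.
    by rewrite invr_gt0 ltr0n; near: L; exact: nbhs_infty_gt.
  rewrite /E !entropyZ// /CEofOP !mul_eCE_entropy eCE_entropy; ring.
rewrite DeltaE; apply: cvgB; first apply: cvgB.
- rewrite -[X in _ --> X]mul1r; apply: cvgM; first exact: cvg_subn_ratio.
  apply: entropy_cvg => i j.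
  rewrite -[X in lincomb X](min_idPr (ltW gamma1)).
  rewrite -[X in 1 - X](min_idPr (ltW gamma1)).
  exact: (cvg_pair_count_splice id 1 i j ltr01 (cvg_divn_self R)).
- by apply: entropy_cvg => i j; exact: cvg_pair_count_splice.
- apply: entropy_cvg => i j.
  apply: (@cvg_trans _ ((L%:R^-1 * (pair_count (p L) d L i j)%:R
     - L%:R^-1 * (pair_count (p L) d (t L + d)%N i j)%:R : R) @[L --> \oo])).
    apply: near_eq_cvg; near=> L.
    suff tL : (t L + d <= L)%N.
      by rewrite (pair_count_catB R _ _ d (t L + d)%N) ?mulrBr// leq_addl.
    have L0 : (0 : R) < L%:R by rewrite ltr0n; near: L; exact: nbhs_infty_gt.
    rewrite -(ler_nat R) -[leRHS]mul1r -ler_pdivrMr// ltW//.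
    near: L; exact: (cvgr_lt _ tdc).
  have -> : lincomb (gamma - mu) P (1 - theta - (gamma - mu)) Q i j =
      lincomb (Num.min 1 gamma) P (1 - Num.min 1 gamma) Q i j
      - lincomb mu P (theta - mu) Q i j.
    by rewrite (min_idPr (ltW gamma1)) /lincomb; ring.
  apply: cvgB; last exact: cvg_pair_count_splice.
  exact: (cvg_pair_count_splice id 1 i j ltr01 (cvg_divn_self R)).
Unshelve. all: by end_near. Qed.

End paths.

Lemma has_pair_probs_ge0 (disp : measure_display) (Omega : measurableType disp)
    (R : realType) (Pr : probability Omega R) (d : nat)
    (X : nat -> {RV Pr >-> R}) (P : 'S_d.+1 -> 'S_d.+1 -> R) :
  has_pair_probs X P -> forall i j, 0 <= P i j.
Proof.
by move=> XP i j; rewrite -lee_fin -(XP i j d (leqnn d)); exact: measure_ge0.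
Qed.

Lemma ordinal_ergodic_all (disp : measure_display)
    (Omega : measurableType disp) (R : realType) (Pr : probability Omega R)
    (d : nat) (X : nat -> {RV Pr >-> R}) (P : 'S_d.+1 -> 'S_d.+1 -> R) :
  ordinal_ergodic X P ->
  {ae Pr, forall w, forall i j : 'S_d.+1,
    (n%:R^-1 * (pair_count (patterns d (fun s => X s w)) d (d + n)%N i j)%:R)
      @[n --> \oo] --> P i j}.
Proof.
by move=> XP; apply: filter_forall => i; apply: filter_forall => j; exact: XP.
Qed.

Theorem theorem5 (disp : measure_display) (Omega : measurableType disp)
    (R : realType) (Pr : probability Omega R) (d : nat) (hd : (0 < d)%N)
    (Y Z : nat -> {RV Pr >-> R}) (P Q : 'S_d.+1 -> 'S_d.+1 -> R)
    (Ystat : ordinal_stationary d Y) (YP : has_pair_probs Y P)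
    (Yerg : ordinal_ergodic Y P)
    (Zstat : ordinal_stationary d Z) (ZQ : has_pair_probs Z Q)
    (Zerg : ordinal_ergodic Z Q)
    (gamma : R) (gamma0 : 0 < gamma) (gamma1 : gamma < 1)
    (theta : R) (theta0 : 0 < theta) (theta1 : theta < 1) :
  {ae Pr, forall w,
    (fun L : nat =>
       L%:R^-1 *
       CEofOP R L (Num.truncn (theta * L%:R))
         (patterns d (splice (Num.truncn (gamma * L%:R))
                             (fun t => Y t w) (fun t => Z t w))))
      @ \oo --> Delta gamma theta P Q}.
Proof.
apply: filterS2 (ordinal_ergodic_all _ _ _ _ _ _ _ Yerg)
  (ordinal_ergodic_all _ _ _ _ _ _ _ Zerg) => w yP zQ.
by apply: cvg_CEofOP_splice => //;
  [exact: has_pair_probs_ge0 YP | exact: has_pair_probs_ge0 ZQ].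
Qed.
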